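(* Let $(\mu,\widetilde x)=(\mu,Wz)$ be a Ritz pair, let $(z\ \ Z_\perp)$ be unitary, and consider the decomposition $$\begin{pmatrix}z^H\\ Z_\perp^H\end{pmatrix}B(\mu)(z\ \ Z_\perp)=\begin{pmatrix}0&z^HB(\mu)Z_\perp\\0&C(\mu)\end{pmatrix},\qquad C(\mu)=Z_\perp^HB(\mu)Z_\perp.$$ Let $\widehat x=Wy$ be the refined Ritz vector corresponding to $\mu$. If $\sigma_{\min}(C(\mu))>0$, then $$\frac{\widehat\sigma_1\|(WZ_\perp)^Hs\|}{\sigma_{\max}(C(\mu))}\leq\sin\angle(\widetilde x,\widehat x)\leq\frac{\widehat\sigma_1\|W^Hs\|}{\sigma_{\min}(C(\mu))}$$ with $s$ being the left singular vector of $T(\mu)W$ corresponding to its smallest singular value $\widehat\sigma_1$.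
   Context: $\Omega\subseteq\mathbb{C}$ is a connected open set and $T:\Omega\to\mathbb{C}^{n\times n}$ is an analytic matrix-valued function that is regular, i.e. $\det T(\lambda)$ is not identically zero on $\Omega$. $\|\cdot\|$ is the 2-norm, $H$ denotes conjugate transpose, $\sigma_{\min}$ and $\sigma_{\max}$ denote the smallest and largest singular values, and $\angle(\cdot,\cdot)$ is the acute angle between the lines spanned by two nonzero vectors. $\mathcal{W}\subset\mathbb{C}^n$ is an $m$-dimensional subspace, $W\in\mathbb{C}^{n\times m}$ has orthonormal columns spanning $\mathcal{W}$, and $B(\lambda)=W^HT(\lambda)W$. The Ritz value $\mu\in\Omega$ and unit vector $z$ satisfy $B(\mu)z=0$, with $\mu$ selected to approximate a desired simple eigenvalue $\lambda_*$ of $T$; $\widetilde x=Wz$ is the Ritz vector. The refined Ritz vector $\widehat x\in\mathcal{W}$ is a unit-length vector satisfying $\|T(\mu)\widehat x\|=\min_{v\in\mathcal{W},\|v\|=1}\|T(\mu)v\|$; equivalently $\widehat x=Wy$, where $y$ is the unit right singular vector of $T(\mu)W$ associated with its smallest singular value $\widehat\sigma_1$. The unit left singular vector $s$ is paired with $y$, so $T(\mu)Wy=\widehat\sigma_1s$. *)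

(* Defs.v *)
From HB Require Import structures.
From mathcomp Require Import all_boot all_order all_algebra.
From mathcomp Require Import all_classical all_reals all_analysis.
From mathcomp.real_closed Require Import complex.

Set Implicit Arguments.
Unset Strict Implicit.
Unset Printing Implicit Defensive.

Import Order.TTheory GRing.Theory Num.Theory.
Import numFieldNormedType.Exports.

Local Open Scope classical_set_scope.
Local Open Scope ring_scope.
Local Open Scope sesquilinear_scope.

(* Complex analysis is phrased over a numFieldType K, whose topology is that of
   its K-valued norm; it is used with K := R[i]. *)

Definition is_domain (K : numFieldType) (Omega : set K) : Prop :=
  open Omega /\ connected Omega.

Definition analytic_on (K : numFieldType) (Omega : set K) (f : K -> K) : Prop :=
  forall a : K, Omega a ->
    exists (c : nat -> K) (r : K), 0 < r /\
      forall x : K, `|x - a| < r ->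
        series (fun j : nat => c j * (x - a) ^+ j) @ \oo --> f x.

Definition analytic_mx_on (K : numFieldType) (n : nat) (Omega : set K)
    (T : K -> 'M[K]_n) : Prop :=
  forall i j : 'I_n, analytic_on Omega (fun x => T x i j).

Definition regular_mx_on (K : numFieldType) (n : nat) (Omega : set K)
    (T : K -> 'M[K]_n) : Prop :=
  exists x : K, Omega x /\ \det (T x) != 0.

(* Algebraic simplicity: x is a simple zero of det T. *)
Definition simple_eigenvalue (K : numFieldType) (n : nat) (Omega : set K)
    (T : K -> 'M[K]_n) (x : K) : Prop :=
  [/\ Omega x, \det (T x) = 0 & derive1 (fun t : K => \det (T t)) x != 0].

Section HermitianGeometry.
Variable R : realType.

Definition norm2 (n : nat) (x : 'cV[R[i]]_n) : R :=
  Num.sqrt (\sum_(i < n) complex.Re `|x i 0| ^+ 2).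

Definition angle (n : nat) (x y : 'cV[R[i]]_n) : R :=
  acos (complex.Re `|(x^t* *m y) 0 0| / (norm2 x * norm2 y)).

(* The square roots of the eigenvalues of A^H A: for n >= m these are the
   singular values of A, with multiplicity, in no particular order.  (For n < m
   the list also contains m - n spurious zeros; that case is not used.) *)
Definition singular_value (n m : nat) (A : 'M[R[i]]_(n, m)) (j : 'I_m) : R :=
  Num.sqrt (complex.Re (spectral_diag (A^t* *m A) 0 j)).

Definition sigma_max (n m : nat) (A : 'M[R[i]]_(n, m)) : R :=
  \big[Num.max/0]_(j < m) singular_value A j.

(* Starting the minimum at sigma_max A does not affect it when m > 0; a matrix
   without columns gets sigma_min A = sigma_max A = 0. *)
Definition sigma_min (n m : nat) (A : 'M[R[i]]_(n, m)) : R :=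
  \big[Num.min/sigma_max A]_(j < m) singular_value A j.

Definition singular_triplet (n m : nat) (A : 'M[R[i]]_(n, m)) (sigma : R)
    (u : 'cV[R[i]]_n) (v : 'cV[R[i]]_m) : Prop :=
  [/\ norm2 u = 1, norm2 v = 1,
      A *m v = (sigma%:C)%C *: u & A^t* *m u = (sigma%:C)%C *: v].

Definition left_singular_vector (n m : nat) (A : 'M[R[i]]_(n, m)) (sigma : R)
    (u : 'cV[R[i]]_n) : Prop :=
  exists v : 'cV[R[i]]_m, singular_triplet A sigma u v.

Definition orthonormal_basis_of (n m : nat) (V : {vspace 'cV[R[i]]_n})
    (W : 'M[R[i]]_(n, m)) : Prop :=
  W^t* *m W = 1%:M /\ <<[seq col j W | j <- enum 'I_m]>>%VS = V.

Definition projected (n m : nat) (T : R[i] -> 'M[R[i]]_n)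
    (W : 'M[R[i]]_(n, m)) (x : R[i]) : 'M[R[i]]_m :=
  W^t* *m T x *m W.

Definition ritz_pair (n m : nat) (Omega : set R[i]) (T : R[i] -> 'M[R[i]]_n)
    (W : 'M[R[i]]_(n, m)) (mu : R[i]) (z : 'cV[R[i]]_m) : Prop :=
  [/\ Omega mu, norm2 z = 1 & projected T W mu *m z = 0].

Definition refined_ritz_vector (n : nat) (T : R[i] -> 'M[R[i]]_n)
    (V : {vspace 'cV[R[i]]_n}) (mu : R[i]) (x : 'cV[R[i]]_n) : Prop :=
  [/\ x \in V, norm2 x = 1 &
      forall v : 'cV[R[i]]_n, v \in V -> norm2 v = 1 ->
        norm2 (T mu *m x) <= norm2 (T mu *m v)].

End HermitianGeometry.

(* Main.v *)
(* Writing y = z a + Zperp b and using B(mu) z = 0, one gets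
   C b = Zperp^H B(mu) y = sigma1 (W Zperp)^H s.  As z and y are unit vectors,
   |a| is the cosine of the angle, so its sine is ||b||; both bounds then follow from
   sigma_min(C) ||b|| <= ||C b|| <= sigma_max(C) ||b||. *)

Require Import Defs.
From HB Require Import structures.
From mathcomp Require Import all_boot all_order all_algebra.
From mathcomp Require Import all_classical all_reals all_analysis.
From mathcomp.real_closed Require Import complex.

Set Implicit Arguments.
Unset Strict Implicit.
Unset Printing Implicit Defensive.

Import Order.TTheory GRing.Theory Num.Theory.
Import numFieldNormedType.Exports.

Local Open Scope classical_set_scope.
Local Open Scope ring_scope.
Local Open Scope sesquilinear_scope.

Lemma adjmxM (F : numClosedFieldType) (m n p : nat) (A : 'M[F]_(m, n))
    (B : 'M[F]_(n, p)) : (A *m B)^t* = B^t* *m A^t*.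
Proof. by rewrite trmx_mul map_mxM. Qed.

Lemma adj_row_mx (F : numClosedFieldType) (m n p : nat) (A : 'M[F]_(m, n))
    (B : 'M[F]_(m, p)) : (row_mx A B)^t* = col_mx (A^t*) (B^t*).
Proof. by rewrite tr_row_mx map_col_mx. Qed.

Section Norm2.
Variable R : realType.

Lemma Re_norm_sqr (a : R[i]) : ((complex.Re `|a| ^+ 2)%:C)%C = `|a| ^+ 2.
Proof. by rewrite rmorphXn; congr (_ ^+ 2); apply: RRe_real; exact: normr_real. Qed.

Lemma norm2_ge0 (n : nat) (x : 'cV[R[i]]_n) : 0 <= norm2 x.
Proof. exact: sqrtr_ge0. Qed.

Lemma sqr_norm2 (n : nat) (x : 'cV[R[i]]_n) :
  norm2 x ^+ 2 = \sum_(i < n) complex.Re `|x i 0| ^+ 2.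
Proof. by rewrite sqr_sqrtr ?sumr_ge0// => i _; exact: sqr_ge0. Qed.

(** Moves squared norms into [R[i]], where they are matrix products from which unitary factors
    cancel. *)
Lemma sqr_norm2C (n : nat) (x : 'cV[R[i]]_n) :
  ((norm2 x ^+ 2)%:C)%C = (x^t* *m x) 0 0.
Proof.
rewrite sqr_norm2 rmorph_sum mxE; apply: eq_bigr => i _.
by rewrite !mxE [LHS]Re_norm_sqr normCKC.
Qed.

Lemma norm2_isometry (n m : nat) (U : 'M[R[i]]_(n, m)) (x : 'cV[R[i]]_m) :
  U^t* *m U = 1%:M -> norm2 (U *m x) = norm2 x.
Proof.
move=> UU; apply/eqP; rewrite -(eqrXn2 (n := 2))//; last 2 first.
- exact: norm2_ge0.
- exact: norm2_ge0.
apply/eqP/complexI; rewrite [LHS]sqr_norm2C [RHS]sqr_norm2C adjmxM.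
by rewrite mulmxA -(mulmxA (x^t*)) UU mulmx1.
Qed.

Lemma norm2_scale_ge0 (n : nat) (c : R) (x : 'cV[R[i]]_n) : 0 <= c ->
  norm2 ((c%:C)%C *: x) = c * norm2 x.
Proof.
move=> c0; rewrite -{2}(ger0_norm c0) -sqrtr_sqr -sqrtrM ?sqr_ge0// mulr_sumr.
congr Num.sqrt; apply: eq_bigr => i _.
(* The real part of the complex-valued norm is, by conversion, the real modulus [Normc.normc], which
   is multiplicative. *)
rewrite mxE -[complex.Re _]/(Normc.normc _) Normc.normcM exprMn; congr (_ * _).
by rewrite /= expr0n/= addr0 sqrtr_sqr real_normK ?num_real.
Qed.

Lemma sqr_norm2_col_mx (m n : nat) (u : 'cV[R[i]]_m) (v : 'cV[R[i]]_n) :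
  norm2 (col_mx u v) ^+ 2 = norm2 u ^+ 2 + norm2 v ^+ 2.
Proof.
rewrite !sqr_norm2 big_split_ord/=.
by congr (_ + _); apply: eq_bigr => i _; rewrite (col_mxEu, col_mxEd).
Qed.

Lemma sqr_norm2_1 (a : 'cV[R[i]]_1) : norm2 a ^+ 2 = complex.Re `|a 0 0| ^+ 2.
Proof. by rewrite sqr_norm2 big_ord1. Qed.

End Norm2.

Section SingularValues.
Variables (R : realType) (n m : nat) (A : 'M[R[i]]_(n, m)).

Let P := spectralmx (A^t* *m A).
Let d := spectral_diag (A^t* *m A).

(** The Gram matrix is Hermitian, hence normal, so the spectral theorem applies. *)
Let gramE : A^t* *m A = P^t* *m diag_mx d *m P.
Proof.
rewrite -invmx_unitary ?spectral_unitarymx//; apply/orthomx_spectralP/normalmxP.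
by rewrite adjmxM trmxCK.
Qed.

Let PPt : P *m P^t* = 1%:M.
Proof. exact/unitarymxP/spectral_unitarymx. Qed.

Let PtP : P^t* *m P = 1%:M.
Proof. exact/mulmx1C/PPt. Qed.

(** An eigenvalue of the Gram matrix is the squared norm of the image under [A] of a unit
    eigenvector, a column of [P^t*]. It is thus real and nonnegative, and [complex.Re] and
    [Num.sqrt] lose nothing. *)
Lemma sqr_singular_value (j : 'I_m) : ((singular_value A j ^+ 2)%:C)%C = d 0 j.
Proof.
have dE : d 0 j = ((norm2 (A *m P^t* *m delta_mx j 0) ^+ 2)%:C)%C.
  rewrite [RHS]sqr_norm2C -mulmxA adjmxM -mulmxA (mulmxA (A^t*)) gramE adjmxM trmxCK.
  rewrite !mulmxA -(mulmxA _ P) PPt mulmx1 -(mulmxA _ P) PPt mulmx1.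
  rewrite -mulmxA mul_diag_mx mxE (bigD1 j)//= big1 => [|i ij]; last first.
    by rewrite !mxE (negPf ij)/= !mulr0.
  by rewrite !mxE !eqxx/= conjC1 mulr1 mul1r addr0.
by rewrite sqr_sqrtr -/d dE//= ?sqr_ge0.
Qed.

Lemma singular_value_ge0 (j : 'I_m) : 0 <= singular_value A j.
Proof. exact: sqrtr_ge0. Qed.

Lemma sigma_max_ge0 : 0 <= sigma_max A.
Proof. exact: bigmax_ge_id. Qed.

Lemma sigma_min_ge0 : 0 <= sigma_min A.
Proof. by apply: le_bigmin => [|j _]; [exact: sigma_max_ge0 | exact: singular_value_ge0]. Qed.

(** The quadratic form of the Gram matrix in its eigenbasis. As [P] is an isometry, both singular
    value bounds follow by comparing this sum term by term with the squared norm of [P *m x]. *)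
Lemma sqr_norm2_mulmx (x : 'cV[R[i]]_m) :
  norm2 (A *m x) ^+ 2
  = \sum_(j < m) singular_value A j ^+ 2 * complex.Re `|(P *m x) j 0| ^+ 2.
Proof.
apply: complexI; rewrite [LHS]sqr_norm2C adjmxM -mulmxA (mulmxA (A^t*)) gramE.
rewrite !mulmxA -adjmxM -2!mulmxA mul_diag_mx mxE rmorph_sum/=.
apply: eq_bigr => j _; rewrite rmorphM/= sqr_singular_value Re_norm_sqr.
by rewrite normCKC !mxE mulrCA.
Qed.

Lemma norm2_mulmx_ge (x : 'cV[R[i]]_m) : sigma_min A * norm2 x <= norm2 (A *m x).
Proof.
rewrite -ler_sqr ?nnegrE ?mulr_ge0 ?norm2_ge0 ?sigma_min_ge0//.
rewrite exprMn -(norm2_isometry x PtP) sqr_norm2 mulr_sumr sqr_norm2_mulmx.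
apply: ler_sum => j _; rewrite ler_wpM2r ?sqr_ge0// lerXn2r ?nnegrE//.
- exact: sigma_min_ge0.
- exact: singular_value_ge0.
- exact: bigmin_le.
Qed.

Lemma norm2_mulmx_le (x : 'cV[R[i]]_m) : norm2 (A *m x) <= sigma_max A * norm2 x.
Proof.
rewrite -ler_sqr ?nnegrE ?mulr_ge0 ?norm2_ge0 ?sigma_max_ge0//.
rewrite exprMn -(norm2_isometry x PtP) [X in _ * X]sqr_norm2 mulr_sumr sqr_norm2_mulmx.
apply: ler_sum => j _; rewrite ler_wpM2r ?sqr_ge0// lerXn2r ?nnegrE//.
- exact: singular_value_ge0.
- exact: sigma_max_ge0.
- exact: le_bigmax.
Qed.

End SingularValues.

Lemma sigma_min_le_max (R : realType) (n m : nat) (A : 'M[R[i]]_(n, m)) :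
  sigma_min A <= sigma_max A.
Proof. exact: bigmin_le_id. Qed.

(** Pythagoras in the orthonormal basis formed by [z] and the columns of [Zperp]. *)
Lemma sqr_norm2_unitary (R : realType) (k : nat) (z : 'cV[R[i]]_(1 + k))
    (Zperp : 'M[R[i]]_(1 + k, k)) (x : 'cV[R[i]]_(1 + k)) :
  row_mx z Zperp \is unitarymx ->
  norm2 (z^t* *m x) ^+ 2 + norm2 (Zperp^t* *m x) ^+ 2 = norm2 x ^+ 2.
Proof.
move=> ZU; rewrite -sqr_norm2_col_mx -mul_col_mx -adj_row_mx norm2_isometry//.
by rewrite trmxCK; exact/unitarymxP.
Qed.

(** [W] preserves inner products, so the cosine is the modulus of the [z]-coordinate of [y];
    Pythagoras leaves the other coordinates for the sine. *)
Lemma sin_angle_unitary (R : realType) (n k : nat) (W : 'M[R[i]]_(n, 1 + k))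
    (z y : 'cV[R[i]]_(1 + k)) (Zperp : 'M[R[i]]_(1 + k, k)) :
  W^t* *m W = 1%:M -> row_mx z Zperp \is unitarymx ->
  norm2 z = 1 -> norm2 y = 1 ->
  sin (angle (W *m z) (W *m y)) = norm2 (Zperp^t* *m y).
Proof.
move=> WW ZU z1 y1; rewrite /angle (norm2_isometry z WW) (norm2_isometry y WW) z1 y1 mulr1 divr1.
rewrite adjmxM mulmxA -(mulmxA (z^t*)) WW mulmx1.
set c := complex.Re _.
have c0 : 0 <= c by rewrite -lecR RRe_real ?normr_real ?normr_ge0.
have cb : c ^+ 2 + norm2 (Zperp^t* *m y) ^+ 2 = 1.
  by rewrite /c -sqr_norm2_1 sqr_norm2_unitary// y1 expr1n.
have c1 : c <= 1.
  by rewrite -(@expr_le1 _ 2)// -cb lerDl sqr_ge0.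
(* The formula for the sine of [acos c] requires [c] between -1 and 1. *)
rewrite sin_acos ?c1 ?(le_trans _ c0) ?lerN10//.
by rewrite -cb addrAC subrr add0r sqrtr_sqr ger0_norm ?norm2_ge0.
Qed.

Lemma norm2_adj_unitary_le (R : realType) (k : nat) (z : 'cV[R[i]]_(1 + k))
    (Zperp : 'M[R[i]]_(1 + k, k)) (x : 'cV[R[i]]_(1 + k)) :
  row_mx z Zperp \is unitarymx -> norm2 (Zperp^t* *m x) <= norm2 x.
Proof.
move=> ZU; rewrite -ler_sqr ?nnegrE ?norm2_ge0//.
by rewrite -(sqr_norm2_unitary x ZU) lerDr sqr_ge0.
Qed.

(* The dimension of the search space Wsp is m = 1 + k. *)
Theorem theorem5p1 (R : realType) (n k : nat) (Omega : set R[i])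
    (T : R[i] -> 'M[R[i]]_n)
    (Wsp : {vspace 'cV[R[i]]_n}) (W : 'M[R[i]]_(n, 1 + k))
    (lambda_star mu : R[i])
    (z : 'cV[R[i]]_(1 + k)) (Zperp : 'M[R[i]]_(1 + k, k))
    (y : 'cV[R[i]]_(1 + k)) (s : 'cV[R[i]]_n)
    (Omega_domain : is_domain Omega)
    (T_analytic : analytic_mx_on Omega T)
    (T_regular : regular_mx_on Omega T)
    (lambda_star_simple : simple_eigenvalue Omega T lambda_star)
    (dim_Wsp : (\dim Wsp = 1 + k)%N)
    (W_basis : orthonormal_basis_of Wsp W)
    (mu_z_ritz : ritz_pair Omega T W mu z)
    (zZ_unitary : row_mx z Zperp \is unitarymx)
    (Wy_refined : refined_ritz_vector T Wsp mu (W *m y))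
    (s_left : left_singular_vector (T mu *m W) (sigma_min (T mu *m W)) s)
    (s_paired : T mu *m W *m y = ((sigma_min (T mu *m W))%:C)%C *: s) :
  let B := projected T W in
  let C := Zperp^t* *m B mu *m Zperp in
  let sigma1 := sigma_min (T mu *m W) in
  col_mx (z^t*) (Zperp^t*) *m B mu *m row_mx z Zperp
    = block_mx 0 (z^t* *m B mu *m Zperp) 0 C
  /\ (0 < sigma_min C ->
      sigma1 * norm2 ((W *m Zperp)^t* *m s) / sigma_max C
        <= sin (angle (W *m z) (W *m y))
        <= sigma1 * norm2 (W^t* *m s) / sigma_min C).
Proof.
move=> B C sigma1.
have [WW _] := W_basis; have [_ z1 Bz] := mu_z_ritz.
split.
  rewrite mul_col_mx mul_col_row -(mulmxA (z^t*) _ z) -(mulmxA (Zperp^t*) _ z).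
  by rewrite (_ : B mu *m z = 0)// !mulmx0.
move=> Cmin0.
(* Both denominators are now positive. For [k = 0] both are 0, so [Cmin0] excludes that case. *)
have Cmax0 : 0 < sigma_max C := lt_le_trans Cmin0 (sigma_min_le_max C).
have y1 : norm2 y = 1.
  by case: Wy_refined => _ + _; rewrite norm2_isometry.
have yE : y = z *m (z^t* *m y) + Zperp *m (Zperp^t* *m y).
  rewrite !mulmxA -mulmxDl -mul_row_col -adj_row_mx.
  by rewrite (unitarymxP zZ_unitary) mul1mx.
have By : B mu *m y = (sigma1%:C)%C *: (W^t* *m s).
  by rewrite /B /projected -!mulmxA (mulmxA (T mu)) s_paired -scalemxAr.
have s0 : 0 <= sigma1 := sigma_min_ge0 _.
have Cb : C *m (Zperp^t* *m y) = (sigma1%:C)%C *: ((W *m Zperp)^t* *m s).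
  (* Only the right-hand side is expanded, since [y] also occurs on the left; [B mu] then kills the
     [z] component. *)
  rewrite adjmxM -mulmxA scalemxAr -By [in RHS]yE mulmxDr.
  rewrite (mulmxA (B mu) z) (_ : B mu *m z = 0)// mul0mx add0r /C.
  by rewrite -(mulmxA (Zperp^t* *m B mu)) -(mulmxA (Zperp^t*)).
have nCb : norm2 (C *m (Zperp^t* *m y)) = sigma1 * norm2 ((W *m Zperp)^t* *m s).
  by rewrite Cb norm2_scale_ge0.
rewrite (sin_angle_unitary WW zZ_unitary)//; apply/andP; split.
  by rewrite ler_pdivrMr// -nCb mulrC norm2_mulmx_le.
(* After the lower singular value bound for [C], the component of [W^t* *m s] along [z] is restored,
   which can only increase the norm. *)
rewrite ler_pdivlMr// [leLHS]mulrC (le_trans (norm2_mulmx_ge _ _))// nCb.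
by rewrite ler_wpM2l// adjmxM -mulmxA (norm2_adj_unitary_le _ zZ_unitary).
Qed.
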